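(* Let $G$ be a snark with a normal $5$-edge-coloring $\sigma$, let $C$ be a cycle of length $g$ in $G$, and let $\tilde{G}\in\mathcal{G}_{C}(\mathcal{A},\mathcal{B})$ be a superposition of $G$ along $C$, with superedges $\mathcal{B}_0,\ldots,\mathcal{B}_{g-1}$. If the superedge $\mathcal{B}_{i}$ is both doubly-right and doubly-left for every $i=0,\ldots,g-1$, then $\tilde{G}$ has a normal $5$-edge-coloring.
   Context: Graphs are simple, cubic and bridgeless. A snark is a bridgeless cubic graph that is not $3$-edge-colorable (no further girth or connectivity condition). Multipoles and normal colorings. A (cubic) multipole consists of vertices, edges (with two end-vertices) and semiedges (with one end-vertex), each vertex being incident to exactly three edges or semiedges. A proper $k$-edge-coloring of a cubic graph or multipole assigns to edges and semiedges colors from $\{1,\ldots,k\}$ so that those incident to the same vertex get distinct colors. For a vertex $v$, $\sigma(v)$ is the set of three colors at $v$. An edge $uv$ is poor (resp. rich) if $|\sigma(u)\cup\sigma(v)|=3$ (resp. $=5$). A normal $5$-edge-coloring is a proper $5$-edge-coloring in which every edge is poor or rich (no requirement on semiedges). A Kempe $(a,b)$-chain is a path that starts and ends with a semiedge and whose (semi)edges are alternately colored $a$ and $b$. Color schemes. If $s$ is a semiedge with end-vertex $v$, its color scheme is $\sigma[s]=(a,\{b,c\})$, where $a=\sigma(s)$ and $b,c$ are the two other colors at $v$. Schemes $(a,\{b,c\})$ and $(a',\{b',c'\})$ are consistent if $a=a'$ and $\{b,c\}$ equals $\{b',c'\}$ or $\{1,2,3,4,5\}\setminus\{a',b',c'\}$.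 Superedges. For a snark $H$ and distinct nonadjacent vertices $x,y$ of $H$, $H_{x,y}$ is the multipole obtained from $H$ by deleting $x$ and $y$ and turning each edge incident to $x$ or $y$ into a semiedge at its remaining end-vertex. The three semiedges coming from $x$ form the left connector and are labelled $s_1^l,s_2^l,s_3^l$; the three coming from $y$ form the right connector and are labelled $s_1^r,s_2^r,s_3^r$. Superpositions. Let $C=u_0u_1\cdots u_{g-1}u_0$ be a cycle in $G$ (indices modulo $g$), let $v_i$ be the neighbor of $u_i$ other than $u_{i-1},u_{i+1}$, and $f_i=u_iv_i$. A superposition $\tilde G\in\mathcal{G}_C(\mathcal{A},\mathcal{B})$ is any cubic graph obtained from the following data, for each $i=0,\ldots,g-1$: a superedge $\mathcal{B}_i=H_{x,y}$ ($H$ a snark, $x,y$ distinct nonadjacent vertices of $H$, all possibly depending on $i$), a supervertex type $\mathcal{A}_i\in\{A,A'\}$, a permutation $p_i$ of $\{1,2,3\}$ and a dock index $d_i\in\{1,2,3\}$. It is constructed as follows: delete from $G$ the edges of $C$ (keeping the vertices $u_i$, the edges $f_i$ and the rest of $G$) and add disjoint copies of $\mathcal{B}_0,\ldots,\mathcal{B}_{g-1}$; for each $i$ and each $j\in\{1,2,3\}$, join the right semiedge $s^r_{p_{i-1}^{-1}(j)}$ of $\mathcal{B}_{i-1}$ with the left semiedge $s^l_j$ of $\mathcal{B}_i$ into one edge; subdivide the edge obtained for $j=d_i$ by the vertex $u_i$ (so $u_i$ has degree 3, its third edge being $f_i$). If $\mathcal{A}_i=A$ nothing more is done at $i$. If $\mathcal{A}_i=A'$,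 each of the two edges obtained for $j\neq d_i$ is subdivided by one new vertex, and these two new vertices are joined by an edge. Right superedges. A superedge $\mathcal{B}_i$ is $j$-right ($j\in\{1,2,3\}$) if it has a normal $5$-edge-coloring such that: the color schemes of $s_j^l$ and of all three right semiedges are consistent with $(3,\{1,2\})$; the color schemes of the two left semiedges other than $s_j^l$ are consistent with $(2,\{1,3\})$; and there is a Kempe $(2,1)$-chain connecting these two left semiedges. $\mathcal{B}_i$ is doubly-right if it is $j$-right for at least two distinct values of $j\in\{1,2,3\}$. Left superedges. For $j,k\in\{1,2,3\}$, a $j,k$-left coloring $L^i_{j,k}((1,2),3,(2,1))$ of $\mathcal{B}_i$ is a normal $5$-edge-coloring of $\mathcal{B}_i$ such that: the color schemes of $s_j^l$ and $s_k^r$ are consistent with $(3,\{1,2\})$; the color schemes of the two left semiedges other than $s_j^l$ are consistent with $(1,\{2,3\})$; the color schemes of the two right semiedges other than $s_k^r$ are consistent with $(2,\{1,3\})$; and there is a Kempe $(1,2)$-chain connecting the two left semiedges other than $s_j^l$. $\mathcal{B}_i$ is doubly-left if for every $j\in\{1,2,3\}$ it has such a $j,k$-left coloring for at least two distinct values of $k\in\{1,2,3\}$. *)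

(* Defs.v *)
From HB Require Import structures.
From mathcomp Require Import all_boot fingroup perm.

Set Implicit Arguments.
Unset Strict Implicit.
Unset Printing Implicit Defensive.

Record sgraph := SGraph {
  svertex :> finType;
  sadj : rel svertex;
  sadj_sym : symmetric sadj;
  sadj_irr : irreflexive sadj }.

(* The edges of a multipole form a simple graph, which is all that arises from
   simple graphs; several semiedges may share their end-vertex. *)
Record multipole := Multipole {
  mvertex :> finType;
  madj : rel mvertex;
  madj_sym : symmetric madj;
  madj_irr : irreflexive madj;
  semiedge : finType;
  send : semiedge -> mvertex }.

Definition graph_multipole (G : sgraph) : multipole :=
  @Multipole G (@sadj G) (@sadj_sym G) (@sadj_irr G) void (fun s => of_void G s).

Coercion graph_multipole : sgraph >-> multipole.

Section Multipoles.
Variable M : multipole.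

(* [inl w] stands for the edge joining [v] to [w], [inr s] for the semiedge [s]. *)
Definition incident (v : M) : {set M + semiedge M} :=
  [set h | match h with inl w => madj v w | inr s => send s == v end].

Definition cubic : Prop := forall v : M, #|incident v| = 3.

(* The value of [ecol] at a pair of nonadjacent vertices is irrelevant. *)
Record edge_coloring (k : nat) := EdgeColoring {
  ecol : M -> M -> 'I_k;
  scol : semiedge M -> 'I_k;
  ecol_sym : forall u v, madj u v -> ecol u v = ecol v u }.

Definition icol k (c : edge_coloring k) (v : M) (h : M + semiedge M) : 'I_k :=
  match h with inl w => ecol c v w | inr s => scol c s end.

Definition proper_coloring k (c : edge_coloring k) : Prop :=
  forall v : M, {in incident v &, injective (icol c v)}.

Definition palette k (c : edge_coloring k) (v : M) : {set 'I_k} :=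
  [set icol c v h | h in incident v].

Definition poor k (c : edge_coloring k) (u v : M) : bool :=
  #|palette c u :|: palette c v| == 3.

Definition rich k (c : edge_coloring k) (u v : M) : bool :=
  #|palette c u :|: palette c v| == 5.

Definition normal_coloring (c : edge_coloring 5) : Prop :=
  proper_coloring c /\ forall u v : M, madj u v -> poor c u v || rich c u v.

Definition scheme k (c : edge_coloring k) (s : semiedge M) : 'I_k * {set 'I_k} :=
  (scol c s, palette c (send s) :\ scol c s).

(* A chain is directed from [s] to [t]; the colour of [s] is [a]. *)
Definition kempe_chain k (c : edge_coloring k) (a b : 'I_k)
    (s t : semiedge M) : Prop :=
  exists p : seq M,
    [/\ path (@madj M) (send s) p, last (send s) p = send t,
        uniq (send s :: p) &
        scol c s :: rcons (pairmap (ecol c) (send s) p) (scol c t)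
          = mkseq (fun n => if odd n then b else a) (size p).+2].

End Multipoles.

Definition del_edge (G : sgraph) (u v : G) : rel G :=
  fun a b => sadj a b && ([set a; b] != [set u; v]).

Definition bridge (G : sgraph) (u v : G) : bool :=
  sadj u v && (n_comp (@sadj G) predT < n_comp (del_edge u v) predT).

Definition bridgeless (G : sgraph) : Prop := forall u v : G, ~~ bridge u v.

Definition snark (G : sgraph) : Prop :=
  [/\ cubic G, bridgeless G & ~ exists c : edge_coloring G 3, proper_coloring c].

(* The colours 1, ..., 5 are the ordinals 0, ..., 4. *)
Definition color (n : nat) : 'I_5 := inord n.-1.

Definition consistent (s t : 'I_5 * {set 'I_5}) : Prop :=
  s.1 = t.1 /\ (s.2 = t.2 \/ s.2 = ~: (t.1 |: t.2)).

Definition color_scheme (a b c : nat) : 'I_5 * {set 'I_5} :=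
  (color a, [set color b; color c]).

(* [se_l] and [se_r] are the labellings of the edges at [se_x] and at [se_y]:
   [s_j^l] comes from the edge joining [se_x] to [se_l j].  As [se_H] is cubic
   they enumerate all neighbours. *)
Record superedge := Superedge {
  se_H : sgraph;
  se_snark : snark se_H;
  se_x : se_H;
  se_y : se_H;
  se_neq : se_x != se_y;
  se_nadj : ~~ sadj se_x se_y;
  se_l : 'I_3 -> se_H;
  se_l_inj : injective se_l;
  se_l_adj : forall j, sadj se_x (se_l j);
  se_r : 'I_3 -> se_H;
  se_r_inj : injective se_r;
  se_r_adj : forall j, sadj se_y (se_r j) }.

Section SuperedgeMultipole.
Variable B : superedge.

Definition se_vertex : finType := {v : se_H B | v \notin [:: se_x B; se_y B]}.

Definition se_adj : rel se_vertex := fun u v => sadj (val u) (val v).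

Lemma se_adj_sym : symmetric se_adj.
Proof. by move=> u v; rewrite /se_adj sadj_sym. Qed.

Lemma se_adj_irr : irreflexive se_adj.
Proof. by move=> u; rewrite /se_adj sadj_irr. Qed.

Lemma se_l_in j : se_l B j \notin [:: se_x B; se_y B].
Proof.
have Hj := se_l_adj B j; rewrite !inE; apply/norP; split; apply/eqP => E.
  by rewrite E sadj_irr in Hj.
by move: Hj; rewrite E; apply/negP; exact: se_nadj.
Qed.

Lemma se_r_in j : se_r B j \notin [:: se_x B; se_y B].
Proof.
have Hj := se_r_adj B j; rewrite !inE; apply/norP; split; apply/eqP => E.
  by move: Hj; rewrite E sadj_sym; apply/negP; exact: se_nadj.
by rewrite E sadj_irr in Hj.
Qed.

Definition se_end (s : 'I_3 + 'I_3) : se_vertex :=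
  match s with
  | inl j => Sub (se_l B j) (se_l_in j)
  | inr j => Sub (se_r B j) (se_r_in j)
  end.

Definition superedge_multipole : multipole :=
  @Multipole se_vertex se_adj se_adj_sym se_adj_irr ('I_3 + 'I_3)%type se_end.

End SuperedgeMultipole.

Coercion superedge_multipole : superedge >-> multipole.

Definition left_semi (B : superedge) (j : 'I_3) : semiedge B := inl j.
Definition right_semi (B : superedge) (j : 'I_3) : semiedge B := inr j.

Section RightLeft.
Variable B : superedge.
Local Notation sl := (left_semi B).
Local Notation sr := (right_semi B).

Definition kempe_left_others (c : edge_coloring B 5) (a b : nat) (j : 'I_3) : Prop :=
  exists m n : 'I_3, [/\ m != n, m != j, n != j &
    kempe_chain c (color a) (color b) (sl m) (sl n)].

Definition is_right (j : 'I_3) : Prop :=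
  exists c : edge_coloring B 5,
    [/\ normal_coloring c,
        consistent (scheme c (sl j)) (color_scheme 3 1 2),
        forall k, consistent (scheme c (sr k)) (color_scheme 3 1 2),
        forall m, m != j -> consistent (scheme c (sl m)) (color_scheme 2 1 3) &
        kempe_left_others c 2 1 j].

Definition doubly_right : Prop :=
  exists j j' : 'I_3, [/\ j != j', is_right j & is_right j'].

Definition left_coloring (j k : 'I_3) (c : edge_coloring B 5) : Prop :=
  normal_coloring c /\
  [/\ consistent (scheme c (sl j)) (color_scheme 3 1 2),
      consistent (scheme c (sr k)) (color_scheme 3 1 2),
      forall m, m != j -> consistent (scheme c (sl m)) (color_scheme 1 2 3),
      forall m, m != k -> consistent (scheme c (sr m)) (color_scheme 2 1 3) &
      kempe_left_others c 1 2 j].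

Definition is_left (j k : 'I_3) : Prop :=
  exists c : edge_coloring B 5, left_coloring j k c.

Definition doubly_left : Prop :=
  forall j, exists k k' : 'I_3, [/\ k != k', is_left j k & is_left j k'].

End RightLeft.

Record graph_cycle (G : sgraph) (g : nat) := GraphCycle {
  cyc_at :> 'I_g -> G;
  cyc_len : 3 <= g;
  cyc_inj : injective cyc_at;
  cyc_adj : forall i, sadj (cyc_at i) (cyc_at (ordS i)) }.

Inductive supervertex := SvA | SvA'.

Definition is_SvA' (a : supervertex) : bool := if a is SvA' then true else false.

Section Superposition.
Variables (G : sgraph) (g : nat) (C : graph_cycle G g).
Variables (A : 'I_g -> supervertex) (B : 'I_g -> superedge).
Variables (p : 'I_g -> {perm 'I_3}) (d : 'I_g -> 'I_3).

Definition cycle_edge (a b : G) : bool :=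
  [exists i, [set a; b] == [set C i; C (ordS i)]].

(* The [j]-th of the three edges joining [B_(i-1)] to [B_i] runs from
   [conn_r i j] to [conn_l i j] (before any subdivision). *)
Definition conn_l (i : 'I_g) (j : 'I_3) : {i : 'I_g & B i} :=
  Tagged (fun i => mvertex (B i)) (send (left_semi (B i) j)).

Definition conn_r (i : 'I_g) (j : 'I_3) : {i : 'I_g & B i} :=
  Tagged (fun i => mvertex (B i))
    (send (right_semi (B (ord_pred i)) ((p (ord_pred i))^-1%g j))).

(* The new vertices subdividing the edges [j != d i] when [A i] is [SvA']. *)
Definition sub_vertex : finType :=
  {n : 'I_g * 'I_3 | is_SvA' (A n.1) && (n.2 != d n.1)}.

Definition sp_vertex : finType := (G + ({i : 'I_g & B i} + sub_vertex))%type.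

Definition sp_arc (a b : sp_vertex) : bool :=
  match a, b with
  | inl u, inl v => sadj u v && ~~ cycle_edge u v
  | inl u, inr (inl w) =>
      [exists i, (u == C i) && ((w == conn_l i (d i)) || (w == conn_r i (d i)))]
  | inr (inl z), inr (inl w) =>
         (tag z == tag w) && madj (tagged z) (tagged_as z w)
      || [exists i, exists j, [&& ~~ is_SvA' (A i), j != d i,
            z == conn_r i j & w == conn_l i j]]
  | inr (inr n), inr (inl w) =>
      (w == conn_l (val n).1 (val n).2) || (w == conn_r (val n).1 (val n).2)
  | inr (inr n), inr (inr n') => ((val n).1 == (val n').1) && (n != n')
  | _, _ => false
  end.

Definition sp_adj : rel sp_vertex := fun a b => sp_arc a b || sp_arc b a.

Lemma sp_adj_sym : symmetric sp_adj.
Proof. by move=> a b; rewrite /sp_adj orbC. Qed.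

Lemma ord_pred_neq (i : 'I_g) : ord_pred i != i.
Proof.
have g3 := cyc_len C; have g0 : 0 < g := ltn_trans (isT : 0 < 2) g3.
have ig := ltn_ord i; apply/eqP => /(congr1 val) /=.
case: (posnP i) => [-> | i0].
  by rewrite add0n modn_small ?prednK // => E; move: g3; rewrite -(prednK g0) E.
rewrite -subn1 addnC -addnBA // modnDl modn_small.
  by move/eqP; rewrite subn1 ltn_eqF // prednK.
exact: leq_ltn_trans (leq_subr _ _) ig.
Qed.

Lemma sp_adj_irr : irreflexive sp_adj.
Proof.
move=> a; rewrite /sp_adj orbb; case: a => [u|[z|n]] /=.
- by rewrite sadj_irr.
- have -> : tagged_as z z = tagged z by case: z => i v; exact: tagged_asE.
  rewrite se_adj_irr andbF /=; apply/existsP => -[i /existsP[j]].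
  case/and4P=> _ _ /eqP-> /eqP/(congr1 tag) /= /eqP.
  by rewrite (negPf (ord_pred_neq i)).
- by rewrite !eqxx.
Qed.

Definition superposition : sgraph := SGraph sp_adj_sym sp_adj_irr.

End Superposition.

(* Main.v *)
Require Import Defs.
From mathcomp Require Import all_boot fingroup perm.

(** Write [E] for an edge of the cycle [C], of colour [a], and [U], [W] for the
    palettes in [sigma] of its two ends.  Either [U = W] or [W] consists of [a]
    and the two colours outside [U]; by symmetry, a semiedge of colour [a] is
    consistent with one end of [E] as soon as it is consistent with the other.
    The colouring of the superposition keeps [sigma] off the cycle, keeps its
    palette at every vertex of [C], and gives the vertices subdividing the lines
    between two superedges the palette of the vertex of [C] standing there.  All
    that remains is to colour each superedge so that its semiedges fit these
    palettes ([glue_normal]).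

    A right colouring sends the colour [a] through all three right semiedges,
    so the superedge that follows it must carry its own colour [b] on the dock.
    A left colouring sends [a] only through the [k]-th right semiedge; on the
    other two lines it can send [b], so that [a] and [b] may trade places at the
    dock.  Whatever line [k] leads to, there is then a line on which the next
    superedge may carry [b] ([connection_colors]), and it is a bijective function
    of that line ([line_perm]).  So it suffices to colour one
    superedge by a right colouring and all the others by left ones
    ([schedule]): starting behind the right coloured superedge, every left
    coloured one takes up the line dictated by its predecessor.  The cycle
    closes because the last left coloured superedge has two possible values of
    [k] and the right coloured one two possible values of [j], and two
    two-element sets of lines among three always meet.

    The delicate point is an edge [E] with [U <> W]: a left colouring shows a
    single palette at both connectors, whereas the left connector should see [U]
    and the right one [W].  Here the Kempe chain helps more than by exchanging
    its two colours.  Consecutive vertices of a [(1,2)]-chain share the colours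
    1 and 2, so that the edge joining them is poor; hence every vertex of the
    chain has the palette [{1,2,3}], and every edge leaving the chain has colour
    3.  Such an edge does not care which of the pairs [{1,2}] and [{4,5}]
    is used at either of its ends, so the chain can be recoloured with any
    permutation that fixes 3 and preserves the pairing, and independently of the
    rest of the superedge ([kempe_switch], [left_realise]). *)

Set Implicit Arguments.
Unset Strict Implicit.
Unset Printing Implicit Defensive.

(** * Recolouring by permutations that vary from vertex to vertex *)

Section Recolor.
Variables (M : multipole) (k : nat) (c : edge_coloring M k).
Variable f : M -> {perm 'I_k}.
Hypothesis f_edge :
  forall x y, madj x y -> f x (ecol c x y) = f y (ecol c x y).

Lemma recolor_sym x y :
  madj x y -> f x (ecol c x y) = f y (ecol c y x).
Proof. by move=> xy; rewrite (f_edge xy) (ecol_sym c xy). Qed.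

Definition recolor : edge_coloring M k :=
  EdgeColoring (fun s => f (send s) (scol c s)) recolor_sym.

Lemma icol_recolor x h :
  h \in incident x -> icol recolor x h = f x (icol c x h).
Proof. by rewrite inE; case: h => [y|s] //= /eqP->. Qed.

Lemma palette_recolor x : palette recolor x = f x @: palette c x.
Proof.
by rewrite /palette -imset_comp; apply: eq_in_imset => h; apply: icol_recolor.
Qed.

Lemma recolor_proper : proper_coloring c -> proper_coloring recolor.
Proof.
move=> cP x h h' hx h'x; rewrite !icol_recolor // => /perm_inj; exact: cP.
Qed.

End Recolor.

Lemma card_palette (M : multipole) k (c : edge_coloring M k) (x : M) :
  cubic M -> proper_coloring c -> #|palette c x| = 3.
Proof. by move=> M3 cP; rewrite card_in_imset ?M3 //; exact: cP. Qed.

Lemma icol_palette (M : multipole) k (c : edge_coloring M k) (x : M) h :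
  h \in incident x -> icol c x h \in palette c x.
Proof. exact: imset_f. Qed.

Lemma ecol_palette (M : multipole) k (c : edge_coloring M k) (x y : M) :
  madj x y -> ecol c x y \in palette c x.
Proof. by move=> xy; apply: (@icol_palette _ _ c x (inl y)); rewrite inE. Qed.

Lemma ecol_palette_r (M : multipole) k (c : edge_coloring M k) (x y : M) :
  madj x y -> ecol c x y \in palette c y.
Proof.
by move=> xy; rewrite (ecol_sym c xy) ecol_palette // madj_sym.
Qed.

Lemma scol_palette (M : multipole) k (c : edge_coloring M k) (s : semiedge M) :
  scol c s \in palette c (send s).
Proof. by apply: (@icol_palette _ _ c _ (inr s)); rewrite inE /=. Qed.

(** * Neighbourhoods in cubic graphs and superedges *)

Definition nbrs (G : sgraph) (u : G) : {set G} := [set w | sadj u w].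

Lemma card_nbrs (G : sgraph) (u : G) : cubic G -> #|nbrs u| = 3.
Proof.
move=> G3; rewrite -(G3 u).
have inj_inl : injective (@inl G (semiedge G)) by move=> ? ? [].
rewrite -(card_imset _ inj_inl); apply: eq_card => -[w|[]]; rewrite [RHS]inE.
apply/imsetP/idP => [[w' + [->]] | uw]; first by rewrite inE.
by exists w; rewrite ?inE.
Qed.

Lemma nbrs_enum (G : sgraph) (u w : G) (f : 'I_3 -> G) :
    cubic G -> injective f -> (forall j, sadj u (f j)) ->
  sadj u w -> exists j, w = f j.
Proof.
move=> G3 injf uf uw.
have /eqP nE : f @: setT == nbrs u.
  rewrite eqEcard card_nbrs // card_imset // cardsT card_ord leqnn andbT.
  by apply/subsetP => _ /imsetP[j _ ->]; rewrite inE.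
have : w \in nbrs u by rewrite inE.
by rewrite -nE => /imsetP[j _ ->]; exists j.
Qed.

(** Each semiedge stands for the deleted edge of the underlying cubic graph, so
    that the edges and semiedges at a vertex match its former neighbours. *)
Lemma superedge_cubic (B : superedge) : cubic B.
Proof.
have [H3 _ _] := se_snark B; move=> v.
rewrite -(card_nbrs (val v) H3).
pose f (h : B + semiedge B) : se_H B :=
  match h with inl w => val w | inr (inl _) => se_x B | inr (inr _) => se_y B end.
have xy := se_neq B.
have vP (w : B) : (val w != se_x B) && (val w != se_y B).
  by have := valP w; rewrite !inE negb_or.
have injf : {in incident v &, injective f}.
  move=> [w|[j|j]] [w'|[j'|j']]; rewrite !inE /=.
  - by move=> _ _ /val_inj->.
  - by move=> _ _ /eqP; rewrite (negPf (proj1 (andP (vP w)))).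
  - by move=> _ _ /eqP; rewrite (negPf (proj2 (andP (vP w)))).
  - by move=> _ _ /esym /eqP; rewrite (negPf (proj1 (andP (vP w')))).
  - by move=> /eqP<- /eqP[] /se_l_inj->.
  - by move=> _ _ /eqP; rewrite (negPf xy).
  - by move=> _ _ /esym/eqP; rewrite (negPf (proj2 (andP (vP w')))).
  - by move=> _ _ /esym/eqP; rewrite (negPf xy).
  - by move=> /eqP<- /eqP[] /se_r_inj->.
rewrite -(card_in_imset injf); apply: eq_card => u; rewrite [RHS]inE.
apply/imsetP/idP => [[[w|[j|j]] + ->] | vu]; rewrite ?inE //=.
- by move/eqP<-; rewrite sadj_sym se_l_adj.
- by move/eqP<-; rewrite sadj_sym se_r_adj.
case: (altP (u =P se_x B)) => [ux|ux].
  have [j vE] := nbrs_enum H3 (@se_l_inj B) (@se_l_adj B)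
    (etrans (sadj_sym _ _) (etrans (congr1 _ (esym ux)) vu)).
  by exists (inr (inl j)); rewrite // inE -val_eqE /= vE.
case: (altP (u =P se_y B)) => [uy|uy].
  have [j vE] := nbrs_enum H3 (@se_r_inj B) (@se_r_adj B)
    (etrans (sadj_sym _ _) (etrans (congr1 _ (esym uy)) vu)).
  by exists (inr (inr j)); rewrite // inE -val_eqE /= vE.
have uB : u \notin [:: se_x B; se_y B] by rewrite !inE negb_or ux uy.
by exists (inl (Sub u uB)); rewrite ?inE.
Qed.

(** * Palettes at the two ends of a normal edge *)

Section Linked.
Implicit Types (x : 'I_5) (U Q R : {set 'I_5}).

(** The palette [Q] may face the palette [U] across an edge of colour [x]: up to
    their order these are the only two palettes through [x] that form, with the
    edge, a poor or a rich edge.  It is an equivalence on palettes containing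
    [x]. *)
Definition linked x U Q : Prop := Q = U \/ Q = x |: ~: U.

Lemma far_endK x U : x \in U -> x |: ~: (x |: ~: U) = U.
Proof. by move=> xU; rewrite setCU setCK setIC -setDE setD1K. Qed.

Lemma linked_sym x U Q : x \in U -> linked x U Q -> linked x Q U.
Proof. by move=> xU [->|->]; [left | right; rewrite far_endK]. Qed.

Lemma linked_trans x U Q R :
  x \in U -> linked x U Q -> linked x Q R -> linked x U R.
Proof.
move=> xU [->|->] // [->|->]; first by right.
by left; rewrite far_endK.
Qed.

Lemma linked_imset (f : {perm 'I_5}) x U Q :
  linked x U Q -> linked (f x) (f @: U) (f @: Q).
Proof.
case=> ->; [by left | right].
rewrite imsetU1; congr (_ |: _); apply/setP=> y.
rewrite -[y](permKV f) (mem_imset _ _ perm_inj) !inE.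
by rewrite (mem_imset _ _ perm_inj).
Qed.

Lemma card_far_end x U : x \in U -> #|U| = 3 -> #|x |: ~: U| = 3.
Proof.
move=> xU U3.
have UC : #|~: U| = 2 by apply/eqP; rewrite -(eqn_add2l #|U|) cardsC card_ord U3.
by rewrite cardsU1 inE xU UC.
Qed.

Lemma linked_card x U Q : x \in U -> #|U| = 3 -> linked x U Q -> #|Q| = 3.
Proof. by move=> xU U3 [->|->] //; apply: card_far_end. Qed.

Definition normal_pair U Q : bool := (#|U :|: Q| == 3) || (#|U :|: Q| == 5).

Lemma normal_pairC U Q : normal_pair U Q = normal_pair Q U.
Proof. by rewrite /normal_pair setUC. Qed.

Lemma linked_normal x U Q :
  x \in U -> #|U| = 3 -> linked x U Q -> normal_pair U Q.
Proof.
rewrite /normal_pair => xU U3 [->|->]; first by rewrite setUid U3.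
by rewrite setUCA setUCr setUT cardsT card_ord.
Qed.

Lemma normal_linked x U Q :
    x \in U -> x \in Q -> #|U| = 3 -> #|Q| = 3 ->
  normal_pair U Q -> linked x U Q.
Proof.
move=> xU xQ U3 Q3 /orP[] /eqP UQ.
  have /eqP E1 : U == U :|: Q by rewrite eqEcard subsetUl UQ U3.
  have /eqP E2 : Q == U :|: Q by rewrite eqEcard subsetUr UQ Q3.
  by left; rewrite E2.
right; apply/esym/eqP; rewrite eqEcard card_far_end // Q3 andbT.
rewrite subUset sub1set xQ /=.
have /eqP UQT : U :|: Q == setT by rewrite eqEcard subsetT UQ cardsT card_ord.
apply/subsetP => y; have := in_setT y; rewrite -UQT !inE.
by case: (y \in U).
Qed.

End Linked.

(** * Switching along Kempe chains *)

Fixpoint alternate (T : Type) (a b : T) (n : nat) : seq T :=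
  if n is m.+1 then a :: alternate b a m else [::].

Lemma alternateE (T : Type) (a b : T) n :
  mkseq (fun i => if odd i then b else a) n = alternate a b n.
Proof.
elim: n a b => //= n IHn a b.
rewrite -IHn /mkseq /= -[1]/(1 + 0) iotaDl -map_comp; congr (_ :: _).
by apply: eq_map => i /=; case: (odd i).
Qed.

Section KempeChain.
Variables (M : multipole) (c : edge_coloring M 5).
Hypotheses (M3 : cubic M) (cN : normal_coloring c).

(** Two palettes of three colours that share two of them have at most four colours
    in all, so a normal edge between them is poor. *)
Lemma adjacent_palettes (x y : M) a b :
    madj x y -> a != b -> a \in palette c x -> b \in palette c x ->
  a \in palette c y -> b \in palette c y -> palette c y = palette c x.
Proof.
move=> xy ab ax bx ay by'; have [cP /(_ _ _ xy)] := cN; rewrite /poor /rich.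
have x3 := card_palette x M3 cP; have y3 := card_palette y M3 cP.
have : 1 < #|palette c x :&: palette c y|.
  apply: leq_trans (subset_leq_card (_ : [set a; b] \subset _)).
    by rewrite cards2 ab.
  by rewrite subUset !sub1set !inE ax ay bx by'.
have := cardsUI (palette c x) (palette c y); rewrite x3 y3 => UI I2.
have /negPf-> : #|palette c x :|: palette c y| != 5.
  by apply/eqP => U5; move: UI I2; rewrite U5; case: #|_| => [|[|]].
rewrite orbF => /eqP U3.
have /eqP yE : palette c y == palette c x :|: palette c y.
  by rewrite eqEcard subsetUr U3 y3.
by apply/eqP; rewrite eq_sym eqEcard x3 y3 andbT yE subsetUl.
Qed.

Lemma walk_color (t : semiedge M) p x a r :
    path (@madj M) x p -> last x p = send t ->
  rcons (pairmap (ecol c) x p) (scol c t) = a :: r -> a \in palette c x.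
Proof.
case: p => [_ /= -> [<- _]|y p /= /andP[xy _] _ [<- _]].
  exact: scol_palette.
exact: ecol_palette.
Qed.

(** The chain is followed from [x] on, having been entered through [h]; the last
    clause says that it uses up both colours at each of its vertices. *)
Lemma kempe_walk (t : semiedge M) p x a b h :
    a != b -> path (@madj M) x p -> last x p = send t ->
    rcons (pairmap (ecol c) x p) (scol c t) = alternate b a (size p).+1 ->
    h \in incident x -> icol c x h = a ->
  forall z, z \in x :: p -> palette c z = palette c x /\
    forall h', h' \in incident z -> icol c z h' \in [set a; b] ->
    [\/ h' = inr t, z = x /\ h' = h | exists2 y, y \in x :: p & h' = inl y].
Proof.
have [cP _] := cN.
elim: p x a b h => [|y p IHp] x a b h ab.
  move=> _ /= xt [tb] hx ha z; rewrite inE => /eqP->; split=> // h' h'x.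
  rewrite !inE => /orP[] /eqP h'c; [constructor 2; split=> // | constructor 1].
    by apply: (cP x) => //; rewrite h'c.
  by apply: (cP x) => //; rewrite ?h'c // inE xt.
move=> /andP[xy yp] yt [xyb pE] hx ha.
have yx : inl x \in incident y by rewrite inE madj_sym.
have yxb : icol c y (inl x) = b by rewrite /= -xyb (ecol_sym c xy).
have /IHp/(_ yp yt pE yx yxb) IH : b != a by rewrite eq_sym.
have yE : palette c y = palette c x.
  apply: (adjacent_palettes xy ab).
  - by rewrite -ha icol_palette.
  - by rewrite -xyb ecol_palette.
  - exact: walk_color yp yt pE.
  - by rewrite -xyb ecol_palette_r.
move=> z; rewrite inE => /predU1P[->|zp].
  split=> // h' h'x; rewrite !inE => /orP[] /eqP h'c.
    by constructor 2; split=> //; apply: (cP x) => //; rewrite h'c.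
  constructor 3; exists y; first by rewrite !inE eqxx orbT.
  by apply: (cP x); rewrite ?h'c // inE.
have [zE zP] := IH z zp; split; first by rewrite zE.
move=> h' h'z; rewrite setUC => /(zP h' h'z)[->|[_ ->]|[w wp ->]].
- by constructor 1.
- by constructor 3; exists x; rewrite ?inE ?eqxx.
- by constructor 3; exists w; rewrite // inE wp orbT.
Qed.

(** The vertex set of a Kempe chain has a single palette, and apart from the two
    semiedges of the chain only edges of the third colour leave it. *)
Lemma kempe_closed a b (s t : semiedge M) :
    a != b -> kempe_chain c a b s t -> exists P : {set M},
  [/\ send s \in P, send t \in P, b \in palette c (send s) &
     forall z, z \in P -> palette c z = palette c (send s) /\
       forall h, h \in incident z -> icol c z h \in [set a; b] ->
       [\/ h = inr s, h = inr t | exists2 y, y \in P & h = inl y]].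
Proof.
move=> ab [p [sp pt _]]; rewrite alternateE => -[sa pE].
exists [set z in send s :: p].
split; first by rewrite inE mem_head.
- by rewrite inE -pt mem_last.
- exact: walk_color sp pt pE.
have sI : inr s \in incident (send s) by rewrite inE /=.
have walk := kempe_walk ab sp pt pE sI sa.
move=> z; rewrite inE => /walk[zE zP]; split=> // h hz /(zP h hz).
case=> [->|[_ ->]|[y yp ->]]; first by constructor 2.
  by constructor 1.
by constructor 3; exists y; rewrite // inE.
Qed.

End KempeChain.

(** The palette [U] is the one that the semiedge is going to face once it is
    joined to something. *)
Definition fits (M : multipole) (c : edge_coloring M 5) (s : semiedge M)
    (x : 'I_5) (U : {set 'I_5}) : Prop :=
  scol c s = x /\ linked x U (palette c (send s)).

Lemma fits_linked (M : multipole) (c : edge_coloring M 5) s x (U W : {set _}) :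
  x \in U -> linked x U W -> fits c s x W -> fits c s x U.
Proof. by move=> xU UW [sx Ws]; split=> //; apply: linked_trans UW Ws. Qed.

Lemma fits_recolor (M : multipole) (c : edge_coloring M 5) f f_edge s x U :
  fits c s x U ->
  fits (@recolor M 5 c f f_edge) s (f (send s) x) (f (send s) @: U).
Proof.
by move=> [<- Us]; split=> //; rewrite palette_recolor; apply: linked_imset.
Qed.

Section KempeSwitch.
Variables (M : multipole) (c : edge_coloring M 5).
Hypotheses (M3 : cubic M) (cN : normal_coloring c).
Variables (a b x : 'I_5).
Hypotheses (ab : a != b) (ax : a != x) (bx : b != x).
Local Notation V := (x |: [set a; b]).

(** The chain is recoloured by [tau] and everything else by [rho].  The edges
    between the two parts have colour [x], on which both permutations agree, and
    they stay normal because [rho @: V] and [tau @: V] are linked: such an edge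
    sees a pair of colours at its end on the chain, and it tolerates this pair as
    well as the complementary one. *)
Lemma kempe_switch (s t : semiedge M) (rho tau : {perm 'I_5}) :
    kempe_chain c a b s t -> linked (scol c s) V (palette c (send s)) ->
    rho x = tau x -> linked (rho x) (rho @: V) (tau @: V) ->
  exists c' : edge_coloring M 5,
  [/\ normal_coloring c',
      forall r y, r = s \/ r = t -> fits c r y V -> fits c' r (tau y) (tau @: V),
      forall r y, y \in [set a; b] -> r <> s -> r <> t ->
        fits c r y V -> fits c' r (rho y) (rho @: V) &
      forall r, fits c r x V -> fits c' r (rho x) (rho @: V)].
Proof.
move=> st sV rtx lrt; have [cP cE] := cN.
have sa : scol c s = a by case: st => q [_ _ _ []].
have V3 : #|V| = 3.
  by rewrite cardsU1 cards2 ab !inE !(eq_sym x) (negPf ax) (negPf bx).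
have [P [sP tP bs Pclosed]] := kempe_closed M3 cN ab st.
(* The scheme of [s] is not the complementary one, as the chain goes on with an
   edge of colour [b] at the end of [s]. *)
have sE : palette c (send s) = V.
  have := cP; case: sV => // sE; move: bs; rewrite sE sa !inE.
  by rewrite eqxx !orbT orbF eq_sym (negPf ab).
have PV z : z \in P -> palette c z = V by move=> /Pclosed[-> _].
pose f z := if z \in P then tau else rho.
have Pleave y z : madj y z -> y \in P -> z \notin P -> ecol c y z = x.
  move=> yz yP zP; have := ecol_palette c yz; rewrite (PV y yP) !inE.
  case: eqP => //= _ yzc; have [_ /(_ (inl z))] := Pclosed y yP.
  rewrite !inE /= yzc => /(_ yz isT) [//|//|[w wP [zw]]].
  by rewrite zw wP in zP.
have f_edge y z : madj y z -> f y (ecol c y z) = f z (ecol c y z).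
  move=> yz; rewrite /f; case: ifP => yP; case: ifP => // zP.
    by rewrite (Pleave _ _ yz) ?zP // rtx.
  by rewrite (ecol_sym c yz) (Pleave z) ?yP // madj_sym.
have crossE y z : madj y z -> y \in P -> z \notin P ->
    normal_pair (tau @: palette c y) (rho @: palette c z).
  move=> yz yP zP; rewrite (PV y yP).
  have xV : x \in V by rewrite !inE eqxx.
  have yzx := Pleave _ _ yz yP zP.
  have zx : x \in palette c z by rewrite -yzx ecol_palette_r.
  apply: (@linked_normal (tau x)); rewrite ?imset_f //.
    by rewrite card_imset //; exact: perm_inj.
  apply: (@linked_trans _ _ (rho @: V)); rewrite ?imset_f //.
    by rewrite -rtx; apply: linked_sym; rewrite ?imset_f.
  rewrite -rtx; apply: linked_imset; apply: normal_linked => //.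
    exact: card_palette.
  by rewrite -(PV y yP); apply: cE.
exists (recolor f_edge); split.
- split=> [|y z yz]; first exact: recolor_proper.
  rewrite /poor /rich -/(normal_pair _ _) !palette_recolor /f /normal_pair.
  case: ifP => yP; case: ifP => zP.
  + by rewrite -imsetU card_imset; [exact: cE | exact: perm_inj].
  + by apply: crossE; rewrite ?zP.
  + by rewrite setUC; apply: crossE; rewrite ?yP // madj_sym.
  + by rewrite -imsetU card_imset; [exact: cE | exact: perm_inj].
- move=> r y rst /(fits_recolor f_edge); rewrite /f.
  by have -> : send r \in P by case: rst => ->.
- move=> r y yab rs rt ry; have /= := fits_recolor f_edge ry; rewrite /f.
  case: ifP => // rP; have [ry' _] := ry.
  have [_ /(_ (inr r))] := Pclosed _ rP; rewrite /= inE ry' eqxx.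
  by case/(_ isT yab) => [[]|[]|[? _]].
- move=> r ry; have /= := fits_recolor f_edge ry; rewrite /f.
  case: ifP => // rP; rewrite rtx => /(fits_linked _); apply.
    by rewrite -rtx imset_f // !inE eqxx.
  by rewrite -rtx.
Qed.

End KempeSwitch.

(** * Colourings of a superedge that fit prescribed palettes *)

Lemma perm_extend3 (T : finType) (x y z x' y' z' : T) :
    x != y -> x != z -> y != z -> x' != y' -> x' != z' -> y' != z' ->
  exists f : {perm T}, [/\ f x = x', f y = y' & f z = z'].
Proof.
move=> xy xz yz x'y' x'z' y'z'.
pose f1 := tperm x x'; pose f2 := tperm (f1 y) y'.
pose f3 := tperm (f2 (f1 z)) z'.
have f1x : f1 x = x' by rewrite tpermL.
have f2x : f2 x' = x'.
  by rewrite tpermD // 1?eq_sym // -f1x (inj_eq perm_inj).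
have f2y : f2 (f1 y) = y' by rewrite tpermL.
exists (f1 * f2 * f3)%g; rewrite !permM; split.
- rewrite f1x f2x tpermD // 1?eq_sym // -f2x -f1x !(inj_eq perm_inj) //.
- by rewrite f2y tpermD // 1?eq_sym // -f2y !(inj_eq perm_inj).
- by rewrite tpermL.
Qed.

Lemma palette_split (U : {set 'I_5}) x y :
    #|U| = 3 -> x \in U -> y \in U -> y != x ->
  exists z, [/\ z != x, z != y & U = x |: [set y; z]].
Proof.
move=> U3 xU yU yx.
have : #|U :\ x :\ y| == 1.
  by move: U3; rewrite (cardsD1 x) (cardsD1 y (U :\ x)) xU !inE yx yU => -[] /eqP.
case/cards1P => z zE; have : z \in U :\ x :\ y by rewrite zE set11.
rewrite !inE => /and3P[zy zx zU]; exists z; split=> //.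
by rewrite -zE setUA -[in RHS]setUA setD1K ?setD1K // !inE yx.
Qed.

Lemma palette_perm (U : {set 'I_5}) (x y z x' y' : 'I_5) :
    y != x -> z != x -> y != z ->
    #|U| = 3 -> x' \in U -> y' \in U -> y' != x' ->
  exists f : {perm 'I_5}, [/\ f x = x', f y = y' & f @: (x |: [set y; z]) = U].
Proof.
move=> yx zx yz U3 x'U y'U y'x'.
have [z' [z'x' z'y' ->]] := palette_split U3 x'U y'U y'x'.
have [f [fx fy fz]] := @perm_extend3 _ x y z x' y' z'
  ltac:(by rewrite eq_sym) ltac:(by rewrite eq_sym) yz
  ltac:(by rewrite eq_sym) ltac:(by rewrite eq_sym) ltac:(by rewrite eq_sym).
by exists f; split=> //; rewrite !imsetU1 imset_set1 fx fy fz.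
Qed.

Lemma consistent_fits (M : multipole) (c : edge_coloring M 5) s x y z :
  consistent (scheme c s) (color_scheme x y z) ->
  fits c s (color x) (color x |: [set color y; color z]).
Proof.
case=> /= sx sE; split=> //; rewrite -(setD1K (scol_palette c s)) sx.
rewrite sx in sE.
by case: sE => ->; [left | right].
Qed.

Local Notation one := (color 1).
Local Notation two := (color 2).
Local Notation three := (color 3).
Local Notation V := (three |: [set one; two]).

Lemma color_neq : [/\ one != two, one != three & two != three].
Proof. by rewrite -!val_eqE /= !inordK. Qed.

Lemma setV1 : one |: [set two; three] = V.
Proof. by apply/setP => x; rewrite !inE; case: eqP; case: eqP; case: eqP. Qed.

Lemma setV2 : two |: [set one; three] = V.
Proof. by apply/setP => x; rewrite !inE; case: eqP; case: eqP; case: eqP. Qed.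

Lemma ord3_others (i j m n : 'I_3) :
  m != n -> m != j -> n != j -> i != j -> i = m \/ i = n.
Proof.
move=> mn mj nj ij.
suff /orP[/eqP->|/eqP->] : (i == m) || (i == n) by [left | right].
by case: i j m n mn mj nj ij
  => [[|[|[|?]]] ?] [[|[|[|?]]] ?] [[|[|[|?]]] ?] [[|[|[|?]]] ?].
Qed.

Section Realise.
Variables (B : superedge) (a : 'I_5) (U W : {set 'I_5}).
Hypotheses (U3 : #|U| = 3) (aU : a \in U) (UW : linked a U W).

(** Since all right semiedges have the colour [a], a palette linked to [U]
    serves them as well as [U] does, and a global permutation of the colours
    suffices. *)
Lemma right_realise j v : is_right B j -> v \in U -> v != a ->
  exists c : edge_coloring B 5,
  [/\ normal_coloring c, fits c (left_semi B j) a U,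
      forall m, m != j -> fits c (left_semi B m) v U &
      forall k, fits c (right_semi B k) a W].
Proof.
have [n12 n13 n23] := color_neq.
move=> [c [[cP cE] lj rk lm _]] vU va.
have [f [fa fv fU]] := palette_perm n23 n13 ltac:(by rewrite eq_sym) U3 aU vU va.
rewrite [[set two; one]]setUC in fU.
have f_edge (x y : B) : madj x y -> f (ecol c x y) = f (ecol c x y) by [].
exists (recolor f_edge); split.
- split=> [|x y xy]; first exact: recolor_proper.
  rewrite /poor /rich !palette_recolor -imsetU card_imset; first exact: cE.
  exact: perm_inj.
- by rewrite -fa -fU; apply/fits_recolor/consistent_fits.
- move=> m /lm/consistent_fits; rewrite setV2 => /(fits_recolor f_edge).
  by rewrite /= fv fU.
- move=> k; have /consistent_fits/(fits_recolor f_edge) := rk k.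
  rewrite /= fa fU; apply: fits_linked; last exact: linked_sym UW.
  by case: UW => ->; rewrite // !inE eqxx.
Qed.

(** The colours [v] and [u] of the two connectors can be prescribed independently
    of each other, even when [U] and [W] only share [a]: the chain, which carries
    the left semiedges other than the [j]-th, gets the palette [U], and the rest
    of the superedge the palettes that suit [W]. *)
Lemma left_realise j k u v : Defs.is_left B j k ->
    v \in U -> v != a -> u \in W -> u != a ->
  exists c : edge_coloring B 5,
  [/\ normal_coloring c, fits c (left_semi B j) a U,
      forall m, m != j -> fits c (left_semi B m) v U,
      fits c (right_semi B k) a W &
      forall m, m != k -> fits c (right_semi B m) u W].
Proof.
have [n12 n13 n23] := color_neq.
move=> [c [cN [lj rk lm rm [m [n [mn mj nj chain]]]]]] vU va uW ua.
have aW : a \in W by case: UW => ->; rewrite // !inE eqxx.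
have W3 : #|W| = 3 by apply: linked_card UW.
have [tau [ta tv tU]] := palette_perm n13 n23 n12 U3 aU vU va.
have [rho [ra ru rW]] :=
  palette_perm n23 n13 ltac:(by rewrite eq_sym) W3 aW uW ua.
rewrite [[set two; one]]setUC in rW.
have lm' i : i != j -> fits c (left_semi B i) one V.
  by move=> /lm/consistent_fits; rewrite setV1.
have [sm Vm] := lm' m mj.
have [] := kempe_switch (@superedge_cubic B) cN n12 n13 n23 chain
  (rho := rho) (tau := tau).
- by rewrite sm.
- by rewrite ra ta.
- by rewrite ra rW tU; apply: linked_sym.
move=> c' [c'N c'l c'r c'3]; exists c'; split=> //.
- have /consistent_fits/c'3 := lj; rewrite ra rW; exact: fits_linked.
- move=> i ij; rewrite -tv -tU; apply: c'l; last exact: lm'.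
  by case: (ord3_others mn mj nj ij) => ->; [left | right].
- by have /consistent_fits/c'3 := rk; rewrite ra rW.
- move=> i ik; rewrite -ru -rW; apply: c'r => //.
    by rewrite !inE eqxx orbT.
  by have /consistent_fits := rm i ik; rewrite setV2.
Qed.

End Realise.

(** * Choosing the colourings around the cycle *)

Lemma ord3_pairs_meet (x y z t : 'I_3) : x != y -> z != t ->
  (x == z) || (x == t) \/ (y == z) || (y == t).
Proof.
move=> xy zt; apply/orP.
by case: x y z t xy zt
  => [[|[|[|?]]] ?] [[|[|[|?]]] ?] [[|[|[|?]]] ?] [[|[|[|?]]] ?].
Qed.

(** The three edges joining consecutive superedges are called lines, the [d]-th
    of which carries the dock.  If the left superedge sends the colour of its
    cycle edge through the line [k] only, then [line_perm sub d k] is the line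
    on which the right superedge is to carry the colour of its own cycle edge,
    [sub] telling whether the lines other than the dock are subdivided.  What
    matters is that it is a bijection. *)
Definition line_perm (sub : bool) (d : 'I_3) : {perm 'I_3} :=
  if sub then 1%g else tperm (ordS d) (ord_pred d).

(** [r] is [None] when the left superedge sends its colour through all lines. *)
Definition next_line (sub : bool) (d : 'I_3) (r : option 'I_3) : 'I_3 :=
  if r is Some k then line_perm sub d k else d.

Lemma tperm_others (d k i : 'I_3) : k != d -> i != d ->
  (i == tperm (ordS d) (ord_pred d) k) = (i != k).
Proof.
move=> kd id'; rewrite -(inj_eq val_inj) permE /=.
by case: d k i kd id' => [[|[|[|?]]] ?] [[|[|[|?]]] ?] [[|[|[|?]]] ?].
Qed.

Lemma tperm_dock (d : 'I_3) : tperm (ordS d) (ord_pred d) d = d.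
Proof. by rewrite tpermD //; case: d => [[|[|[|?]]] ?]. Qed.

Definition right_line (T : Type) (a u : T) (r : option 'I_3) (i : 'I_3) : T :=
  if r is Some k then if i == k then a else u else a.

Definition left_line (T : Type) (b v : T) (j i : 'I_3) : T :=
  if i == j then b else v.

Lemma superedge_realise (B : superedge) (a u v : 'I_5) (U W : {set 'I_5}) j r :
    (if r is Some k then Defs.is_left B j k else is_right B j) ->
    #|U| = 3 -> a \in U -> linked a U W ->
    v \in U -> v != a -> u \in W -> u != a ->
  exists c : edge_coloring B 5,
  [/\ normal_coloring c,
      forall m, fits c (left_semi B m) (left_line a v j m) U &
      forall k, fits c (right_semi B k) (right_line a u r k) W].
Proof.
rewrite /left_line /right_line; case: r => [k|] jr U3 aU UW vU va uW ua.
  have [c [cN lj lm rk rm]] := left_realise U3 aU UW jr vU va uW ua.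
  exists c; split=> // m; case: (altP eqP) => [->|mk] //; first exact: lm.
  exact: rm.
have [c [cN lj lm rk]] := right_realise U3 aU UW jr vU va.
by exists c; split=> // m; case: (altP eqP) => [->|mk] //; exact: lm.
Qed.

(** [a] and [b] are the colours of the cycle edges before and after a vertex of
    the cycle, [t] that of the third edge there, and [z] is meant for the edge
    joining the two subdividing vertices.

    If [r = Some k] with [k <> d], the dock gets [b] and [a] instead of [a] and [b].  Without
    subdivisions the remaining lines show [a] on both sides for [k] and [b] on
    both sides for the third line, which forces the right superedge to have its
    [b] there; with subdivisions [a] and [b] face each other on every line, and
    the right superedge has its [b] on [k]. *)
Lemma connection_colors (T : eqType) (a b t : T) sub d r :
  exists u v z,
  [/\ u \in [:: b; t], v \in [:: a; t],
      perm_eq [:: right_line a u r d; left_line b v (next_line sub d r) d; t]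
              [:: a; b; t] &
      forall i, i != d ->
      let x := right_line a u r i in
      let y := left_line b v (next_line sub d r) i in
      if sub then perm_eq [:: x; y; z] [:: a; b; t] else x == y].
Proof.
have sw x y z : perm_eq [:: x; y; z] [:: y; x; z :> T].
  by apply/permPl; exact: (perm_catCA [:: x] [:: y]).
have sw' x y z : perm_eq [:: x; y; z] [:: x; z; y :> T].
  by rewrite perm_cons; apply/permPl; exact: (perm_catC [:: y] [:: z]).
case: r => [k|]; rewrite /next_line /left_line /line_perm /=; last first.
  exists b, (if sub then t else a), b; rewrite eqxx !inE !eqxx; split=> //.
    by case: sub; rewrite !eqxx ?orbT.
  by move=> i /negPf->; case: sub.
case: sub.
  have k1 : (1%g : {perm 'I_3}) k = k by exact: perm1.
  exists b, a, t; rewrite !inE !eqxx k1; split=> //; first by case: (d == k).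
  by move=> i _; case: (i == k).
case: (altP (k =P d)) => [->|kd].
  exists t, t, t; rewrite !inE !eqxx !orbT tperm_dock eqxx; split=> //.
  by move=> i /negPf->.
exists b, a, t; rewrite !inE !eqxx; split=> //.
  by rewrite eq_sym (negPf kd) -[d in d == _](tperm_dock d) (inj_eq perm_inj)
             eq_sym (negPf kd).
by move=> i id'; rewrite tperm_others //; case: (i == k).
Qed.

Lemma ordS_inord n i : i < n -> ordS (inord i : 'I_n.+1) = inord i.+1.
Proof.
move=> i_n; apply: val_inj; rewrite /= !inordK ?modn_small //.
exact: ltnW.
Qed.

(** [Rt] and [Lf] stand for the available right and left colourings, [r i] is
    [None] at the only superedge coloured by a right one, the index 0.  The lines
    [J] are determined by recursion up to the last superedge, whose own choice
    [kl] has to lead back to a line available at 0. *)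
Lemma schedule (g : nat) (Rt : 'I_g -> 'I_3 -> Prop)
    (Lf : 'I_g -> 'I_3 -> 'I_3 -> Prop) (p : 'I_g -> {perm 'I_3})
    (sub : 'I_g -> bool) (d : 'I_g -> 'I_3) :
    1 < g ->
    (forall i, exists j j', [/\ j != j', Rt i j & Rt i j']) ->
    (forall i j, exists k k', [/\ k != k', Lf i j k & Lf i j k']) ->
  exists (j : 'I_g -> 'I_3) (r : 'I_g -> option 'I_3),
  forall i,
    (if r i is Some k then Lf i (j i) k else Rt i (j i)) /\
    j (ordS i) = next_line (sub (ordS i)) (d (ordS i)) (omap (p i) (r i)).
Proof.
case: g => [//|n] in Rt Lf p sub d *; rewrite ltnS => n0 RtP LfP.
have /fin_all_exists[K KP] i : exists K : 'I_3 -> 'I_3, forall j,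
    Lf i j (K j) /\ exists k', K j != k' /\ Lf i j k'.
  apply: (fin_all_exists
    (P := fun j k => Lf i j k /\ exists k', k != k' /\ Lf i j k')) => j.
  by have [k [k' [kk' ? ?]]] := LfP i j; exists k; split=> //; exists k'.
pose I m : 'I_n.+1 := inord m.
pose step m := next_line (sub (I m)) (d (I m)).
(* [J m] is the left line of the superedge of index [m.+1]. *)
pose J := fix J m : 'I_3 :=
  if m is m'.+1 then step m.+1 (Some (p (I m) (K (I m) (J m'))))
  else step 1 None.
have [j0 [j0' [jj0 Rj0 Rj0']]] := RtP ord0.
have [kl [Lkl]] : exists kl, Lf (I n) (J n.-1) kl /\
    Rt ord0 (step 0 (Some (p (I n) kl))).
  have [LK [k' [Kk' Lk']]] := KP (I n) (J n.-1).
  have inj : injective (fun k => step 0 (Some (p (I n) k))).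
    by move=> ? ?; rewrite /step /= => /perm_inj/perm_inj.
  rewrite -(inj_eq inj) in Kk'.
  case: (ord3_pairs_meet Kk' jj0) => jE; [exists (K (I n) (J n.-1)) | exists k'].
    by split=> //; case/orP: jE => /eqP->.
  by split=> //; case/orP: jE => /eqP->.
exists (fun i => if nat_of_ord i == 0 then step 0 (Some (p (I n) kl))
                 else J (nat_of_ord i).-1).
exists (fun i => if nat_of_ord i == 0 then None else
  if nat_of_ord i == n then Some kl else Some (K i (J (nat_of_ord i).-1))).
move=> i; have iE : i = I i by rewrite /I inord_val.
have I0 : I 0 = ord0 by apply: val_inj; rewrite /= inordK.
split.
  case: eqP => [i0|_]; first by rewrite iE i0 I0.
  case: eqP => [i_n|_]; last by have [] := KP i (J i.-1).
  have -> : i = I n by rewrite iE i_n.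
  by rewrite (inordK (ltnSn n)).
case: (ltnP i n) => i_n.
  have -> : ordS i = I i.+1 by rewrite [in LHS]iE ordS_inord.
  rewrite inordK //= (ltn_eqF i_n); case: (posnP i) => [i0|i0].
    by rewrite i0 /= /step.
  rewrite -[in LHS](prednK i0) -[in RHS](prednK i0) /=.
  by rewrite /step prednK // -iE.
have {}i_n : nat_of_ord i = n by apply/eqP; rewrite eqn_leq i_n -ltnS ltn_ord.
have Si0 : ordS i = ord0 by apply: val_inj; rewrite /= i_n modnn.
have iI : i = I n by rewrite iE i_n.
by rewrite Si0 /= i_n eqxx (gtn_eqF n0) /= /step I0 iI.
Qed.

(** * Checking a colouring vertex by vertex *)

(** Properness and palette at [x], read off from a list of the neighbours of [x]
    by slots [t] whose colours [q t] are known to be distinct: repetitions in the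
    list need not be excluded, since equal neighbours have equal colours. *)
Lemma local_coloring (H : sgraph) (c : edge_coloring H 5) (x : H)
    (T : eqType) (S : {pred T}) (nb : T -> H) (q : T -> 'I_5) (U : {set 'I_5}) :
    {in S &, injective q} ->
    (forall t, t \in S -> sadj x (nb t) /\ ecol c x (nb t) = q t) ->
    (forall y, sadj x y -> exists2 t, t \in S & y = nb t) ->
    (forall e, reflect (exists2 t, t \in S & e = q t) (e \in U)) ->
  {in @incident H x &, injective (icol c x)} /\ palette c x = U.
Proof.
move=> injq nbP nbE UP; split.
  move=> [y|[]] [y'|[]]; rewrite !inE /= => /nbE[t tS ->] /nbE[t' t'S ->].
  by have [_ ->] := nbP t tS; have [_ ->] := nbP t' t'S; move/injq->.
apply/setP => e; apply/imsetP/UP => [[[y|[]]] | [t tS ->]].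
  by rewrite inE /= => /nbE[t tS ->] ->; exists t => //; have [_] := nbP t tS.
have [xt et] := nbP t tS.
by exists (inl (nb t)); rewrite ?inE //=.
Qed.

Lemma local_coloring_seq (H : sgraph) (c : edge_coloring H 5) (x : H)
    (l : seq (H * 'I_5)) (U : {set 'I_5}) :
    uniq (map snd l) -> U =i map snd l ->
    (forall t, t \in l -> sadj x t.1 /\ ecol c x t.1 = t.2) ->
    (forall y, sadj x y -> y \in map fst l) ->
  {in @incident H x &, injective (icol c x)} /\ palette c x = U.
Proof.
move=> ul Ul nbP nbE.
apply: (@local_coloring _ _ _ _ (mem l) fst snd) => //.
- elim: l ul {Ul nbP nbE} => //= s l IHl /andP[sl /IHl{}IHl] t t'.
  rewrite !inE => /predU1P[->|tl] /predU1P[->|t'l] //; last exact: IHl.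
    by move=> st; rewrite st map_f in sl.
  by move=> ts; rewrite -ts map_f in sl.
- by move=> y /nbE/mapP[t tl ->]; exists t.
- by move=> e; rewrite Ul; apply: mapP.
Qed.

(** * The corners of the cycle *)

Section Cycle.
Variables (G : sgraph) (g : nat) (C : graph_cycle G g).

Lemma ordS_neq (i : 'I_g) : ordS i != i.
Proof.
by rewrite -[X in _ != X]ord_predK (inj_eq (@ordS_inj g)) eq_sym
           (ord_pred_neq C).
Qed.

Lemma ord_pred2_neq (i : 'I_g) : ord_pred (ord_pred i) != i.
Proof.
have g3 := cyc_len C; have ig := ltn_ord i; apply/eqP => E.
have : ordS (ordS i) = i by rewrite -[i in LHS]E !ord_predK.
move/eqP; rewrite -val_eqE /= => /eqP; move: (i : nat) ig => {E}k kg.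
have [kg1|kg1] := ltnP k.+1 g; last first.
  have -> : g = k.+1 by apply/eqP; rewrite eqn_leq kg1 kg.
  have k1 : 2 < k.+1 by exact: leq_trans g3 kg1.
  by rewrite modnn modn_small ?(ltn_trans _ k1) // => kE; rewrite -kE in k1.
rewrite (modn_small kg1); have [kg2|kg2] := ltnP k.+2 g.
  by rewrite (modn_small kg2) => /eqP; rewrite gtn_eqF.
have -> : g = k.+2 by apply/eqP; rewrite eqn_leq kg1 kg2.
rewrite modnn => kE; rewrite -kE in kg2.
by have := leq_trans g3 kg2.
Qed.

Lemma cycle_edgeE i (w : G) :
  cycle_edge C (C i) w = (w == C (ordS i)) || (w == C (ord_pred i)).
Proof.
apply/existsP/orP => [[k /eqP E] | ].
  have : C i \in [set C k; C (ordS k)] by rewrite -E set21.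
  have : w \in [set C k; C (ordS k)] by rewrite -E set22.
  have Sk : C (ordS k) \in [set C i; w] by rewrite E set22.
  have k1 : C k \in [set C i; w] by rewrite E set21.
  rewrite !inE => wk /orP[] /eqP/(@cyc_inj _ _ C) ik.
    left; rewrite ik; move: Sk; rewrite !inE ik (inj_eq (@cyc_inj _ _ C)).
    by rewrite (negPf (ordS_neq k)) => /eqP->.
  right; rewrite ik ordSK; move: k1; rewrite !inE ik (inj_eq (@cyc_inj _ _ C)).
  by rewrite eq_sym (negPf (ordS_neq k)) => /eqP->.
case=> /eqP->; [by exists i | exists (ord_pred i)].
by rewrite ord_predK setUC.
Qed.

Lemma cycle_third (G3 : cubic G) :
  exists v : 'I_g -> G, forall i,
  [/\ sadj (C i) (v i), ~~ cycle_edge C (C i) (v i) &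
      forall w, sadj (C i) w -> cycle_edge C (C i) w || (w == v i)].
Proof.
suff: forall i, exists w : G, [/\ sadj (C i) w, ~~ cycle_edge C (C i) w &
    forall w', sadj (C i) w' -> cycle_edge C (C i) w' || (w' == w)].
  by move/fin_all_exists.
move=> i; set u := C i.
pose x := C (ordS i); pose y := C (ord_pred i).
have ux : sadj u x by exact: cyc_adj.
have uy : sadj u y.
  by rewrite sadj_sym /u -[i in C i]ord_predK; exact: cyc_adj.
have xy : y != x.
  rewrite (inj_eq (@cyc_inj _ _ C)) -(inj_eq (@ord_pred_inj g)) ordSK.
  exact: ord_pred2_neq.
have := card_nbrs u G3; rewrite (cardsD1 x) inE ux (cardsD1 y) !inE xy uy.
move=> -[] /eqP/cards1P[v vE].
have : v \in nbrs u :\ x :\ y by rewrite vE set11.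
rewrite !inE => /and3P[vy vx uv]; exists v; split=> //.
  by rewrite cycle_edgeE negb_or vx vy.
move=> w uw; rewrite cycle_edgeE -/x -/y.
have [//|wx /=] := boolP (w == x); have [//|wy /=] := boolP (w == y).
by rewrite -in_set1 -vE !inE wx wy uw.
Qed.

End Cycle.

(** * Gluing the colourings of the pieces *)

Section Gluing.
Variables (G : sgraph) (g : nat) (C : graph_cycle G g).
Variables (A : 'I_g -> supervertex) (B : 'I_g -> superedge).
Variables (p : 'I_g -> {perm 'I_3}) (d : 'I_g -> 'I_3).
Local Notation spv := (sp_vertex G A B d).
Local Notation arc := (@sp_arc G g C A B p d).
Local Notation adj := (@sp_adj G g C A B p d).
Local Notation cl := (@conn_l g B).
Local Notation cr := (@conn_r g B p).
Local Notation gv u := (inl u : spv).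
Local Notation bv w := (inr (inl w) : spv).
Local Notation tg := (Tagged (fun i => mvertex (B i))).
Local Notation sv n := (inr (inr n) : spv).

Variables (sigma : edge_coloring G 5) (c : forall i, edge_coloring (B i) 5).
Variable z : 'I_g -> 'I_5.

Definition line_l (i : 'I_g) (j : 'I_3) : 'I_5 :=
  scol (c i) (left_semi (B i) j).

Definition line_r (i : 'I_g) (j : 'I_3) : 'I_5 :=
  scol (c (ord_pred i))
       (right_semi (B (ord_pred i)) ((p (ord_pred i))^-1%g j)).

(** The colour of an arc from the first vertex to the second; the values for pairs
    that are never arcs are arbitrary.  A line without subdivision is recovered
    from its end in the right superedge. *)
Definition arc_color (a b : spv) : 'I_5 :=
  match a, b with
  | inl u, inl v => ecol sigma u v
  | inl u, inr (inl w) =>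
      let i := tag w in
      if u == C i then line_l i (d i) else line_r (ordS i) (d (ordS i))
  | inr (inl w), inr (inl w') =>
      if tag w == tag w' then ecol (c (tag w)) (tagged w) (tagged_as w w')
      else if [pick j | w' == cl (tag w') j] is Some j then line_l (tag w') j
      else z (tag w')
  | inr (inr n), inr (inl w) =>
      if tag w == (val n).1 then line_l (val n).1 (val n).2
      else line_r (val n).1 (val n).2
  | inr (inr n), inr (inr _) => z (val n).1
  | inl u, inr (inr n) => z (val n).1
  | inr (inl w), inl _ => z (tag w)
  | inr (inr n), inl _ => z (val n).1
  | inr (inl _), inr (inr n) => z (val n).1
  end.

Definition glue_color (a b : spv) : 'I_5 :=
  if arc a b then arc_color a b else arc_color b a.

Lemma arc_inner (i : 'I_g) (v w : B i) :
  arc (bv (tg v)) (bv (tg w)) = madj v w.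
Proof.
rewrite /= eqxx tagged_asE; case: (se_adj v w) => //=.
apply/negbTE/negP => /existsP[k /existsP[j /and4P[_ _]]].
move=> /eqP/(congr1 tag) /= ik /eqP/(congr1 tag) /= ik'.
by have := ord_pred_neq C k; rewrite -ik ik' eqxx.
Qed.

(** Two superedges cannot be joined by lines in both directions, as the cycle has
    length at least three. *)
Lemma arc_colorC a b : arc a b -> arc b a -> arc_color a b = arc_color b a.
Proof.
case: a b => [u|[[i v]|n]] [u'|[[i' v']|n']] //=.
- by case/andP=> uu' _ _; rewrite (ecol_sym sigma uu').
- case: (altP (i =P i')) => [ii'|ii'].
    move: v'; rewrite -ii' => v'; rewrite !tagged_asE eqxx => vv' _.
    case/orP: vv' => [/(ecol_sym (c i)) //|].
    move=> vv'; have : arc (bv (tg v)) (bv (tg v')) by rewrite /= vv' orbT.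
    by rewrite arc_inner => /(ecol_sym (c i)).
  case/existsP=> k /existsP[j /and4P[_ _]].
  move=> /eqP/(congr1 tag) /= ik /eqP/(congr1 tag) /= i'k.
  rewrite eq_sym (negPf ii') /=.
  case/existsP=> l /existsP[j' /and4P[_ _]].
  move=> /eqP/(congr1 tag) /= i'l /eqP/(congr1 tag) /= il.
  by exfalso; have := ord_pred2_neq C k; rewrite -ik il -i'l i'k eqxx.
- by case/andP=> /eqP->.
Qed.

Lemma glue_sym a b : adj a b -> glue_color a b = glue_color b a.
Proof.
rewrite /sp_adj /glue_color; case ab: (arc a b); case ba: (arc b a) => // _.
exact: arc_colorC.
Qed.

Definition glue : edge_coloring (superposition C A B p d) 5 :=
  @EdgeColoring (superposition C A B p d) 5 glue_color
    (fun s => match s : void with end) glue_sym.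

Lemma glue_arc a b : arc a b ->
  [/\ adj a b, adj b a, glue_color a b = arc_color a b
    & glue_color b a = arc_color a b].
Proof.
move=> ab; have adj_ab : adj a b by rewrite /sp_adj ab.
have abE : glue_color a b = arc_color a b by rewrite /glue_color ab.
by split=> //; [rewrite sp_adj_sym | rewrite -abE (glue_sym adj_ab)].
Qed.

Lemma cl_inj i : injective (cl i).
Proof.
move=> j j' /eqP; rewrite /conn_l eq_Tagged /= => /eqP/(congr1 val) /=.
exact: se_l_inj.
Qed.

Lemma arc_dock_l i : arc (gv (C i)) (bv (cl i (d i))).
Proof. by apply/existsP; exists i; rewrite !eqxx. Qed.

Lemma arc_dock_r i : arc (gv (C i)) (bv (cr i (d i))).
Proof. by apply/existsP; exists i; rewrite !eqxx orbT. Qed.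

Lemma color_dock_l i : arc_color (gv (C i)) (bv (cl i (d i))) = line_l i (d i).
Proof. by rewrite /= eqxx. Qed.

Lemma color_dock_r i : arc_color (gv (C i)) (bv (cr i (d i))) = line_r i (d i).
Proof.
rewrite /= (inj_eq (@cyc_inj _ _ C)) eq_sym (negPf (ord_pred_neq C i)).
by rewrite ord_predK.
Qed.

Lemma arc_line i j : ~~ is_SvA' (A i) -> j != d i -> arc (bv (cr i j)) (bv (cl i j)).
Proof.
move=> Ai jd; apply/orP; right; apply/existsP; exists i; apply/existsP; exists j.
by rewrite Ai jd !eqxx.
Qed.

Lemma color_line i j : arc_color (bv (cr i j)) (bv (cl i j)) = line_l i j.
Proof.
rewrite /arc_color ifN; last exact: (ord_pred_neq C).
case: pickP => [k /eqP/cl_inj->|/(_ j)] //.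
by rewrite eqxx.
Qed.

Lemma arc_sub_l (n : sub_vertex A d) : arc (sv n) (bv (cl (val n).1 (val n).2)).
Proof. by rewrite /= eqxx. Qed.

Lemma arc_sub_r (n : sub_vertex A d) : arc (sv n) (bv (cr (val n).1 (val n).2)).
Proof. by rewrite /= eqxx orbT. Qed.

Lemma color_sub_l (n : sub_vertex A d) :
  arc_color (sv n) (bv (cl (val n).1 (val n).2)) = line_l (val n).1 (val n).2.
Proof. by rewrite /= eqxx. Qed.

Lemma color_sub_r (n : sub_vertex A d) :
  arc_color (sv n) (bv (cr (val n).1 (val n).2)) = line_r (val n).1 (val n).2.
Proof. by rewrite /= (negPf (ord_pred_neq C _)). Qed.

(** What the two ends of the line [j] are attached to: the vertex of the cycle, a
    subdividing vertex or, where [insub] finds none, the opposite end. *)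
Definition nb_l (i : 'I_g) (j : 'I_3) : spv :=
  if j == d i then gv (C i)
  else if insub (i, j) is Some n then sv n else bv (cr i j).

Definition nb_r (i : 'I_g) (j : 'I_3) : spv :=
  if j == d i then gv (C i)
  else if insub (i, j) is Some n then sv n else bv (cl i j).

(** The palettes of the glued colouring, as [glue_ok] will show. *)
Definition glue_palette (a : spv) : {set 'I_5} :=
  match a with
  | inl u => palette sigma u
  | inr (inl w) => palette (c (tag w)) (tagged w)
  | inr (inr n) => palette sigma (C (val n).1)
  end.

Variable third : 'I_g -> G.
Hypothesis thirdP : forall i,
  [/\ sadj (C i) (third i), ~~ cycle_edge C (C i) (third i) &
      forall w, sadj (C i) w -> cycle_edge C (C i) w || (w == third i)].

Definition corner_colors (i : 'I_g) : seq 'I_5 :=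
  [:: ecol sigma (C i) (C (ord_pred i)); ecol sigma (C i) (C (ordS i));
      ecol sigma (C i) (third i)].

Lemma cyc_adj_pred i : sadj (C i) (C (ord_pred i)).
Proof. by rewrite sadj_sym -{2}[i]ord_predK; exact: cyc_adj. Qed.

Hypothesis sigmaN : normal_coloring sigma.

Lemma corner_uniq i : uniq (corner_colors i).
Proof.
have [sP _] := sigmaN; have [uv cv _] := thirdP i.
move: cv; rewrite cycle_edgeE negb_or => /andP[v1 v2].
have inj w w' : ecol sigma (C i) w = ecol sigma (C i) w' ->
    sadj (C i) w -> sadj (C i) w' -> w = w'.
  move=> ww' iw iw'.
  suff [] : inl w = inl w' :> G + void by [].
  by apply: (sP (C i)) => //; rewrite inE.
rewrite /= !inE negb_or !andbT; apply/andP; split; first (apply/andP; split).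
- apply/eqP => /inj /(_ (cyc_adj_pred i) (cyc_adj C i))/(@cyc_inj _ _ C) /eqP.
  by rewrite -(inj_eq (@ord_pred_inj g)) ordSK (negPf (ord_pred2_neq C i)).
- apply/eqP => /inj /(_ (cyc_adj_pred i) uv) /eqP.
  by rewrite eq_sym (negPf v2).
- apply/eqP => /inj /(_ (cyc_adj C i) uv) /eqP.
  by rewrite eq_sym (negPf v1).
Qed.

Lemma corner_palette i : palette sigma (C i) =i corner_colors i.
Proof.
have [uv _ vP] := thirdP i.
move=> e; apply/imsetP/idP => [[[w|[]]]|].
  rewrite inE /= => /vP; rewrite cycle_edgeE => /orP[/orP[]|] /eqP-> ->;
  by rewrite !inE eqxx ?orbT.
rewrite !inE => /or3P[]/eqP->.
- by exists (inl (C (ord_pred i))); rewrite // inE; exact: cyc_adj_pred.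
- by exists (inl (C (ordS i))); rewrite // inE; exact: cyc_adj.
- by exists (inl (third i)); rewrite // inE.
Qed.

Hypothesis cN : forall i, normal_coloring (c i).
Hypothesis dockP : forall i,
  perm_eq [:: line_r i (d i); line_l i (d i); ecol sigma (C i) (third i)]
          (corner_colors i).
Hypothesis subP : forall i j, j != d i -> is_SvA' (A i) ->
  perm_eq [:: line_r i j; line_l i j; z i] (corner_colors i).
Hypothesis plainP : forall i j, j != d i -> ~~ is_SvA' (A i) ->
  line_r i j = line_l i j.

Lemma nb_lP i j :
  adj (bv (cl i j)) (nb_l i j) /\ glue_color (bv (cl i j)) (nb_l i j) = line_l i j.
Proof.
rewrite /nb_l; case: (altP (j =P d i)) => [->|jd].
  by have [_ ? _ ->] := glue_arc (arc_dock_l i); rewrite color_dock_l.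
case: insubP => [n _ nE|].
  have [_ adjn _ E] := glue_arc (arc_sub_l n).
  by move: adjn E; rewrite color_sub_l nE.
rewrite /= jd andbT => Ai.
by have [_ ? _ ->] := glue_arc (arc_line Ai jd); rewrite color_line.
Qed.

Lemma nb_rP i j :
  adj (bv (cr i j)) (nb_r i j) /\ glue_color (bv (cr i j)) (nb_r i j) = line_r i j.
Proof.
rewrite /nb_r; case: (altP (j =P d i)) => [->|jd].
  by have [_ ? _ ->] := glue_arc (arc_dock_r i); rewrite color_dock_r.
case: insubP => [n _ nE|].
  have [_ adjn _ E] := glue_arc (arc_sub_r n).
  by move: adjn E; rewrite color_sub_r nE.
rewrite /= jd andbT => Ai.
by have [? _ -> _] := glue_arc (arc_line Ai jd); rewrite color_line plainP.
Qed.

Definition nb_inner (i : 'I_g) (h : B i + semiedge (B i)) : spv :=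
  match h with
  | inl w => bv (tg w)
  | inr (inl j) => nb_l i j
  | inr (inr k) => nb_r (ordS i) (p i k)
  end.

(** The right semiedges of the [i]-th superedge, reached from the superedge rather
    than from the line. *)
Lemma crE i k : cr (ordS i) (p i k) = tg (send (right_semi (B i) k)).
Proof.
rewrite /conn_r; move: (ord_pred (ordS i)) (ordSK i) => i' ->.
by rewrite permK.
Qed.

Lemma line_rE i k : line_r (ordS i) (p i k) = scol (c i) (right_semi (B i) k).
Proof.
rewrite /line_r; move: (ord_pred (ordS i)) (ordSK i) => i' ->.
by rewrite permK.
Qed.

Lemma nb_innerP i (v : B i) h : h \in incident v ->
  adj (bv (tg v)) (nb_inner h) /\ glue_color (bv (tg v)) (nb_inner h) = icol (c i) v h.
Proof.
rewrite inE; case: h => [w|[j|k]] /=.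
- move=> vw; have /glue_arc[? _ -> _] : arc (bv (tg v)) (bv (tg w)).
    by rewrite arc_inner.
  split=> //.
  by rewrite /arc_color /= eqxx tagged_asE.
- by move/eqP<-; exact: nb_lP.
- by move/eqP<-; have := nb_rP (ordS i) (p i k); rewrite crE line_rE.
Qed.

Lemma cl_nb i (v : B i) k j : tg v = cl k j ->
  exists2 h, h \in incident v & nb_inner h = nb_l k j.
Proof.
move=> vE; have ik : i = k by move/(congr1 tag): (vE).
move: vE; rewrite -ik => /eqP; rewrite /conn_l eq_Tagged /= => /eqP->.
by exists (inr (inl j)); rewrite ?inE /=.
Qed.

Lemma cr_nb i (v : B i) k j : tg v = cr k j ->
  exists2 h, h \in incident v & nb_inner h = nb_r k j.
Proof.
rewrite -{1 2}(ord_predK k) -{1 2}(permKV (p (ord_pred k)) j) crE.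
move=> vE; have ik : i = ord_pred k by move/(congr1 tag): (vE).
move: {+}j vE; rewrite -(ord_predK k) ordSK -ik => {}j /eqP.
rewrite eq_Tagged /= => /eqP->.
exists (inr (inr ((p i)^-1%g j))); rewrite ?inE //=.
Qed.

Lemma inner_nbrs i (v : B i) b :
  adj (bv (tg v)) b -> exists2 h, h \in incident v & b = nb_inner h.
Proof.
case/orP; case: b => [u|[[i' w]|n]] //.
- case: (altP (i =P i')) => [ii'|ii'].
    by move: w; rewrite -ii' => w; rewrite arc_inner => vw; exists (inl w); rewrite ?inE.
  rewrite /= (negPf ii') /= => /existsP[k /existsP[j /and4P[Ak jd /eqP vE /eqP->]]].
  have [h hv hE] := cr_nb vE; exists h; rewrite // hE /nb_r (negPf jd).
  by rewrite insubF //= (negPf Ak).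
- case/existsP=> k /andP[/eqP-> /orP[]/eqP vE].
    by have [h hv hE] := cl_nb vE; exists h; rewrite // hE /nb_l eqxx.
  by have [h hv hE] := cr_nb vE; exists h; rewrite // hE /nb_r eqxx.
- case: (altP (i =P i')) => [ii'|ii'].
    move: w; rewrite -ii' => w; rewrite arc_inner madj_sym => vw.
    by exists (inl w); rewrite ?inE.
  rewrite /= eq_sym (negPf ii') /=.
  move=> /existsP[k /existsP[j /and4P[Ak jd /eqP-> /eqP vE]]].
  have [h hv hE] := cl_nb vE; exists h; rewrite // hE /nb_l (negPf jd).
  by rewrite insubF //= (negPf Ak).
- have /andP[_ nd] := valP n.
  have nE : insub ((val n).1, (val n).2) = Some n.
    by rewrite -surjective_pairing valK.
  case/orP=> /eqP vE.
    have [h hv hE] := cl_nb vE; exists h; rewrite // hE /nb_l (negPf nd).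
    by rewrite nE.
  have [h hv hE] := cr_nb vE; exists h; rewrite // hE /nb_r (negPf nd).
  by rewrite nE.
Qed.

Local Notation sp := (superposition C A B p d).
Local Notation local_ok a :=
  ({in @incident sp a &, injective (@icol sp 5 glue a)} /\
   @palette sp 5 glue a = glue_palette a).

Lemma inner_ok i (v : B i) : local_ok (bv (tg v)).
Proof.
have [cP _] := cN i.
apply: (@local_coloring sp glue _ _ (mem (incident v)) (@nb_inner i) (icol (c i) v)).
- exact: cP.
- exact: nb_innerP.
- exact: inner_nbrs.
- by move=> e; apply: imsetP.
Qed.

Lemma arc_outer (u w : G) : adj (gv u) (gv w) = arc (gv u) (gv w).
Proof. by rewrite /sp_adj /= sadj_sym /cycle_edge setUC orbb. Qed.

Lemma corner_ok i : local_ok (gv (C i)).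
Proof.
have [uv cv vP] := thirdP i.
apply: (@local_coloring_seq sp glue _
  [:: (bv (cr i (d i)), line_r i (d i)); (bv (cl i (d i)), line_l i (d i));
      (gv (third i), ecol sigma (C i) (third i))]).
- by rewrite (perm_uniq (dockP i)) corner_uniq.
- by move=> e; rewrite (perm_mem (dockP i)) corner_palette.
- move=> t; rewrite !inE => /or3P[]/eqP-> /=.
  + by have [? _ -> _] := glue_arc (arc_dock_r i); rewrite color_dock_r.
  + by have [? _ -> _] := glue_arc (arc_dock_l i); rewrite color_dock_l.
  + have /glue_arc[? _ -> _] : arc (gv (C i)) (gv (third i)) by rewrite /= uv cv.
    by [].
case=> [w|[w|n]].
- move=> iw; have /andP[/vP] : arc (gv (C i)) (gv w) by rewrite -arc_outer.
  by case/orP=> [->|/eqP-> _] //; rewrite !inE eqxx !orbT.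
- rewrite /= /sp_adj orbF => /existsP[k /andP[/eqP/(@cyc_inj _ _ C)<-]].
  by case/orP=> /eqP->; rewrite !inE eqxx ?orbT.
- by [].
Qed.

Lemma outer_ok u : (forall i, u != C i) -> local_ok (gv u).
Proof.
move=> uC; have [sP _] := sigmaN.
have noC w : ~~ cycle_edge C u w.
  apply/existsP => -[k /eqP E].
  have : u \in [set C k; C (ordS k)] by rewrite -E set21.
  by rewrite !inE (negPf (uC k)) (negPf (uC (ordS k))).
pose nb (h : G + void) : spv := match h with inl w => gv w | inr s => gv u end.
apply: (@local_coloring sp glue _ _ (mem (@incident G u)) nb (icol sigma u)).
- exact: sP.
- case=> [w|[]] uw; rewrite inE /= in uw.
  have /glue_arc[? _ uwE _] : arc (gv u) (gv w) by rewrite /= uw noC.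
  by split; last exact: uwE.
- case=> [w|[w|n]] //.
    move=> uw; have /andP[uw' _] : arc (gv u) (gv w) by rewrite -arc_outer.
    by exists (inl w); rewrite // inE.
  by rewrite /= /sp_adj orbF => /existsP[k]; rewrite (negPf (uC k)).
- by move=> e; apply: imsetP.
Qed.

Lemma sub_ok n : local_ok (sv n).
Proof.
have /andP[nA nd] := valP n.
set i := (val n).1 in nA nd; set k := (val n).2 in nd.
pose m : 'I_3 := tperm (ordS (d i)) (ord_pred (d i)) k.
have md : m != d i by rewrite -[X in _ != X]tperm_dock (inj_eq perm_inj).
have iA : is_SvA' (A (i, m).1) && ((i, m).2 != d (i, m).1) by rewrite nA md.
pose n' : sub_vertex A d := Sub (i, m) iA.
have nn' : n != n'.
  apply/eqP => /(congr1 (fun x : sub_vertex A d => (val x).2))/eqP /=.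
  by rewrite -/k tperm_others // eqxx.
apply: (@local_coloring_seq sp glue _
  [:: (bv (cr i k), line_r i k); (bv (cl i k), line_l i k); (sv n', z i)]).
- by rewrite (perm_uniq (subP nd nA)) corner_uniq.
- by move=> e; rewrite (perm_mem (subP nd nA)) corner_palette.
- move=> t; rewrite !inE => /or3P[]/eqP-> /=.
  + by have [? _ -> _] := glue_arc (arc_sub_r n); rewrite color_sub_r.
  + by have [? _ -> _] := glue_arc (arc_sub_l n); rewrite color_sub_l.
  + have /glue_arc[? _ -> _] : arc (sv n) (sv n') by rewrite /= eqxx nn'.
    by [].
case=> [w|[w|n'']].
- by [].
- by rewrite /= /sp_adj orbF => /orP[]/eqP->; rewrite !inE eqxx ?orbT.
move=> nn''; have {nn''}/andP[/eqP i'' nn''] : arc (sv n) (sv n'').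
  by case/orP: nn'' => //= /andP[/eqP-> ?]; rewrite eqxx eq_sym.
suff -> : n'' = n' by rewrite !inE eqxx !orbT.
have /andP[_ n''d] := valP n''.
apply: val_inj; rewrite /= [LHS]surjective_pairing -i''; congr (_, _).
rewrite -i'' in n''d; apply/eqP; rewrite tperm_others //.
apply: contraNneq nn'' => kk; apply/eqP/val_inj.
by rewrite [LHS]surjective_pairing [RHS]surjective_pairing -i'' kk.
Qed.

Lemma glue_ok a : local_ok a.
Proof.
case: a => [u|[[i v]|n]]; [|exact: inner_ok | exact: sub_ok].
case: (pickP (fun i => u == C i)) => [i /eqP->|uC]; first exact: corner_ok.
by apply: outer_ok => i; rewrite uC.
Qed.

Hypothesis linkl : forall i j,
  linked (line_l i j) (palette sigma (C i)) (palette (c i) (send (left_semi (B i) j))).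
Hypothesis linkr : forall i j,
  linked (line_r i j) (palette sigma (C i)) (glue_palette (bv (cr i j))).
Hypothesis linl : forall i j, line_l i j \in palette sigma (C i).
Hypothesis linr : forall i j, line_r i j \in palette sigma (C i).

Lemma card_corner i : #|palette sigma (C i)| = 3.
Proof. by rewrite (eq_card (@corner_palette i)) (card_uniqP (corner_uniq i)). Qed.

Lemma glue_pair_l i j :
  normal_pair (palette sigma (C i)) (glue_palette (bv (cl i j))).
Proof. exact: linked_normal (linl i j) (card_corner i) (linkl i j). Qed.

Lemma glue_pair_r i j :
  normal_pair (palette sigma (C i)) (glue_palette (bv (cr i j))).
Proof. exact: linked_normal (linr i j) (card_corner i) (linkr i j). Qed.

(** On a line that is not subdivided the two semiedges have the same colour and
    both face the palette of the corner, hence they face each other. *)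
Lemma glue_pair_line i j : j != d i -> ~~ is_SvA' (A i) ->
  normal_pair (glue_palette (bv (cr i j))) (glue_palette (bv (cl i j))).
Proof.
move=> jd Ai; have xl := linl i j; have Ul := linkl i j.
have := linkr i j; rewrite (plainP jd Ai) => Ur.
apply: (@linked_normal (line_l i j)).
- by case: Ur => ->; rewrite // !inE eqxx.
- exact: linked_card (card_corner i) Ur.
- by apply: linked_trans Ul; [case: Ur => ->; rewrite // !inE eqxx | exact: linked_sym].
Qed.

Lemma glue_pair a b : arc a b -> normal_pair (glue_palette a) (glue_palette b).
Proof.
have [_ sE] := sigmaN.
case: a b => [u|[[i v]|n]] [u'|[[i' v']|n']] //.
- by case/andP=> uu' _; apply: sE.
- by case/existsP=> k /andP[/eqP-> /orP[]/eqP->];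
    [exact: glue_pair_l | exact: glue_pair_r].
- case: (altP (i =P i')) => [ii'|ii'].
    by move: v'; rewrite -ii' => v'; rewrite arc_inner; have [_] := cN i; apply.
  rewrite /= (negPf ii') /= => /existsP[k /existsP[j /and4P[Ak jd /eqP vE /eqP wE]]].
  suff : normal_pair (glue_palette (bv (cr k j))) (glue_palette (bv (cl k j))).
    by rewrite -vE -wE.
  exact: glue_pair_line.
- by case/orP=> /eqP->; [exact: glue_pair_l | exact: glue_pair_r].
- by case/andP=> /eqP nn' _; rewrite /normal_pair /= nn' setUid card_corner.
Qed.

Lemma glue_normal : @normal_coloring sp glue.
Proof.
split=> [a|a b ab]; first by case: (glue_ok a).
rewrite /poor /rich; case: (glue_ok a) (glue_ok b) => _ -> [_ ->].
case/orP: ab => /glue_pair //.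
by rewrite normal_pairC.
Qed.

End Gluing.

(** * The theorem *)

Theorem theorem15
  (G : sgraph) (hG : snark G)
  (sigma : edge_coloring G 5) (hsigma : normal_coloring sigma)
  (g : nat) (C : graph_cycle G g)
  (A : 'I_g -> supervertex) (B : 'I_g -> superedge)
  (p : 'I_g -> {perm 'I_3}) (d : 'I_g -> 'I_3)
  (hB : forall i : 'I_g, doubly_right (B i) /\ doubly_left (B i)) :
  exists c : edge_coloring (superposition C A B p d) 5, normal_coloring c.
Proof.
have [G3 _ _] := hG.
have [t tP] := cycle_third C G3.
pose U i : {set 'I_5} := palette sigma (C i).
pose e i := ecol sigma (C i) (C (ordS i)).
have [j [r jr]] :=
  @schedule g (fun i => is_right (B i)) (fun i => Defs.is_left (B i)) p
  (fun i => is_SvA' (A i)) d (ltnW (cyc_len C))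
  (fun i => proj1 (hB i)) (fun i => proj2 (hB i)).
(* [r' i] is the outcome of the preceding superedge in terms of the lines at
   the corner [i]. *)
pose r' i := omap (p (ord_pred i)) (r (ord_pred i)).
have jE i : j i = next_line (is_SvA' (A i)) (d i) (r' i).
  by have [_] := jr (ord_pred i); rewrite ord_predK.
have eS i : ecol sigma (C (ordS i)) (C i) = e i.
  by rewrite (@ecol_sym G) // /= sadj_sym; exact: cyc_adj.
have cornerE i : corner_colors C sigma t i =
    [:: e (ord_pred i); e i; ecol sigma (C i) (t i)].
  by rewrite /corner_colors -(eS (ord_pred i)) ord_predK.
have corner3 i := corner_uniq tP hsigma i.
have cornerP i := corner_palette sigma tP i.
have U3 i : #|U i| = 3 := card_corner tP hsigma i.
have /fin_all_exists[u uP] i := connection_colors (e (ord_pred i)) (e i)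
  (ecol sigma (C i) (t i)) (is_SvA' (A i)) (d i) (r' i).
have {uP}/fin_all_exists[v vP] := uP.
have {vP}/fin_all_exists[z zP] := vP.
have uE i : (u (ordS i) \in U (ordS i)) /\ (u (ordS i) != e i).
  have [uc _ _ _] := zP (ordS i).
  have := corner3 (ordS i); rewrite cornerP cornerE ordSK /= !inE negb_or.
  case/and3P=> /andP[n1 n2] _ _.
  by move: uc; rewrite !inE => /orP[]/eqP->; rewrite eqxx ?orbT eq_sym.
have vE i : (v i \in U i) /\ (v i != e i).
  have [_ vc _ _] := zP i.
  have := corner3 i; rewrite cornerP cornerE /= !inE negb_or.
  case/and3P=> /andP[n1 n2] n3 _.
  by move: vc; rewrite !inE => /orP[]/eqP->; rewrite eqxx ?orbT // eq_sym.
have eU i : e i \in U i by rewrite cornerP cornerE !inE eqxx orbT.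
have eU' i : e i \in U (ordS i) by rewrite cornerP cornerE ordSK !inE eqxx.
have UU i : linked (e i) (U i) (U (ordS i)).
  by apply: normal_linked => //; have [_] := hsigma; apply; exact: cyc_adj.
have /fin_all_exists[c cP] i : exists c : edge_coloring (B i) 5,
    [/\ normal_coloring c,
     forall m, fits c (left_semi (B i) m) (left_line (e i) (v i) (j i) m) (U i) &
     forall k, fits c (right_semi (B i) k)
                 (right_line (e i) (u (ordS i)) (r i) k) (U (ordS i))].
  have [jri _] := jr i; have [? ?] := uE i; have [? ?] := vE i.
  exact: superedge_realise.
have llE i m : line_l c i m = left_line (e i) (v i) (j i) m.
  by have [_ /(_ m)[]] := cP i.
have lrE i m : line_r p c i m = right_line (e (ord_pred i)) (u i) (r' i) m.
  have [_ _ /(_ ((p (ord_pred i))^-1%g m))[+ _]] := cP (ord_pred i).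
  rewrite ord_predK -/(line_r p c i m) => ->; rewrite /r' /right_line.
  by case: (r _) => //= k; rewrite -(inj_eq (@perm_inj _ (p (ord_pred i)))) permKV.
exists (glue C A p d sigma c z); apply: (glue_normal tP hsigma).
- by move=> i; have [] := cP i.
- by move=> i; have [_ _ + _] := zP i; rewrite lrE llE jE cornerE.
- move=> i m md iA; have [_ _ _ /(_ m md)] := zP i; rewrite iA.
  by rewrite lrE llE jE iA cornerE.
- move=> i m md iA; have [_ _ _ /(_ m md)] := zP i; rewrite (negPf iA).
  by rewrite lrE llE jE (negPf iA) => /eqP.
- by move=> i m; rewrite llE; have [_ /(_ m)[]] := cP i.
- move=> i m; have [_ _ /(_ ((p (ord_pred i))^-1%g m))[xE]] := cP (ord_pred i).
  by rewrite -xE ord_predK.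
- move=> i m; rewrite llE /left_line; case: ifP => _ //.
  by have [] := vE i.
- move=> i m; rewrite lrE /right_line.
  have := eU' (ord_pred i); rewrite ord_predK => ?.
  have := uE (ord_pred i); rewrite ord_predK => -[? _].
  by case: (r' i) => // k; case: ifP.
Qed.
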